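(* Let $T>0$ and let $X(\cdot,t)$, $t\in[0,T]$, be a stochastic process with $E[X(\cdot,t)^2]<+\infty$ for all $t\in[0,T]$, mean-square integrable on $[0,T]$, and such that the function $t\mapsto E[X(\cdot,t)^2]$ is bounded or Riemann integrable on $[0,T]$. Let $K\ge1$ be a fixed natural number. For each partition $\triangle_n:0=t_0<t_1<\cdots<t_n=T$ with $n>K$, let $J=\{0,\dots,n-1\}$, let $J_K\subset J$ be any subset with exactly $K$ elements, and let $u_j\in[t_j,t_{j+1}]$ be arbitrary for $j\in J$. Then $$\int_0^T X(t)\,dt=\mathop{\mathrm{l.i.m.}}_{\|\triangle_n\|\to0}\sum_{j=0}^{n-1}X(u_j)(t_{j+1}-t_j)=\mathop{\mathrm{l.i.m.}}_{\|\triangle_n\|\to0}\sum_{j\in J\setminus J_K}X(u_j)(t_{j+1}-t_j).$$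
   Context: $(\Omega,\mathcal F,P)$ is a probability space and $X(t)=X(\cdot,t)$. $\mathrm{l.i.m.}$ denotes limit in mean square, i.e. in $L^2(\Omega,P)$; $\|\triangle_n\|=\max_{0\le i\le n-1}(t_{i+1}-t_i)$. A second-order process $X$ is called mean-square integrable on $[0,T]$ if the limit $\int_0^TX(t)\,dt=\mathop{\mathrm{l.i.m.}}_{\|\triangle_n\|\to0}\sum_{i=0}^{n-1}X(u_i)(t_{i+1}-t_i)$ exists for arbitrary partitions and arbitrary points $u_i\in[t_i,t_{i+1}]$; the limit is the mean-square integral. *)

(* Defs.v *)
From HB Require Import structures.
From mathcomp Require Import all_boot all_order all_algebra.
From mathcomp Require Import all_classical all_reals all_analysis.

Set Implicit Arguments.
Unset Strict Implicit.
Unset Printing Implicit Defensive.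

Import Order.TTheory GRing.Theory Num.Theory.
Import numFieldNormedType.Exports.

Local Open Scope classical_set_scope.
Local Open Scope ring_scope.

(* A partition a = t_0 < t_1 < ... < t_n = b, where [nodes] = [:: t_1; ...; t_n]
   (the library's [itv_partition]), with a point u_j in each [t_j, t_(j+1)]. *)
Record tagged_partition (R : realType) (a b : R) := TaggedPartition {
  nodes : seq R ;
  nodes_itv_partition : itv_partition a b nodes ;
  sample_pt : 'I_(size nodes) -> R ;
  sample_pt_itv : forall j : 'I_(size nodes),
    nth b (a :: nodes) j <= sample_pt j <= nth b (a :: nodes) j.+1 }.

Arguments sample_pt {R a b} t j.

Section riemann_sums.
Context {R : realType} {a b : R}.
Implicit Type D : tagged_partition a b.

Definition cells D : nat := size (nodes D).

Definition cell_width D (j : 'I_(cells D)) : R :=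
  nth b (a :: nodes D) j.+1 - nth b (a :: nodes D) j.

Definition mesh D : R := \big[Num.max/0]_(j < cells D) cell_width j.

Definition riemann_sum (f : R -> R) D : R :=
  \sum_(j < cells D) f (sample_pt D j) * cell_width j.

End riemann_sums.

Definition mesh_to0 (R : realType) (a b : R) : set_system (tagged_partition a b) :=
  filter_from [set e : R | 0 < e] (fun e => [set D | mesh D < e]).

Arguments mesh_to0 {R} a b.

Global Instance mesh_to0_filter (R : realType) (a b : R) :
  Filter (mesh_to0 a b).
Proof.
apply: filter_from_filter; first by exists 1 => /=.
move=> e1 e2 /= e1_gt0 e2_gt0; exists (Num.min e1 e2).
  by rewrite /= lt_min e1_gt0.
by move=> D /=; rewrite lt_min => /andP[].
Qed.

Definition riemann_integrable (R : realType) (f : R -> R) (a b : R) : Prop :=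
  exists l : R, riemann_sum f D @[D --> mesh_to0 a b] --> l.

Section mean_square.
Context {d : measure_display} {Omega : measurableType d} {R : realType}.
Variable P : probability Omega R.

Definition second_moment (Y : Omega -> R) : \bar R :=
  'E_P[(fun w => Y w ^+ 2)].

Definition is_lim_ms {I : Type} (F : set_system I)
    (Z : I -> Omega -> R) (Y : Omega -> R) : Prop :=
  Y \in Lfun P 2%:E /\
  second_moment (fun w => Z i w - Y w) @[i --> F] --> 0%E.

Definition ms_riemann_sum {a b : R} (X : R -> Omega -> R)
    (D : tagged_partition a b) : Omega -> R :=
  fun w => riemann_sum (X ^~ w) D.

Definition is_ms_integral (X : R -> Omega -> R) (a b : R) (Y : Omega -> R) :=
  is_lim_ms (mesh_to0 a b) (ms_riemann_sum X) Y.

Definition ms_integrable (X : R -> Omega -> R) (a b : R) : Prop :=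
  exists Y : Omega -> R, is_ms_integral X a b Y.

(* The integral is only determined up to almost sure equality: this is a chosen
   version of it, and a junk value when X is not mean-square integrable. *)
Definition ms_integral (X : R -> Omega -> R) (a b : R) : Omega -> R :=
  xget (cst 0) [set Y | is_ms_integral X a b Y].

End mean_square.

(* Main.v *)
(* The K dropped cells contribute sum_(j in J_K) X(u_j) (t_(j+1) - t_j), whose
   second moment is at most K^2 ||D||^2 sup_t E[X(t)^2] by Cauchy-Schwarz.  The
   supremum is finite as soon as X is mean-square integrable: mean-square
   Riemann sums over one fine partition stay bounded when a single tag moves. *)
Require Import Defs.
From HB Require Import structures.
From mathcomp Require Import all_boot all_order all_algebra.
From mathcomp Require Import all_classical all_reals all_analysis.
From mathcomp Require Import measurable_realfun ring.
Import Order.TTheory GRing.Theory Num.Theory.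
Import numFieldNormedType.Exports.
Local Open Scope classical_set_scope.
Local Open Scope ring_scope.

(** * Cauchy-Schwarz for finite sums and for their second moments *)

Lemma sqr_sum_le (R : realDomainType) (I : Type) (s : seq I) (a : I -> R) :
  (\sum_(i <- s) a i) ^+ 2 <= (size s)%:R * \sum_(i <- s) a i ^+ 2.
Proof.
have sum_cst (b : R) : \sum_(j <- s) b = (size s)%:R * b.
  by rewrite big_const_seq count_predT iter_addr_0 mulr_natl.
(* By Lagrange's identity this double sum is twice the right side minus the left side of the
   claim. *)
have : 0 <= \sum_(i <- s) \sum_(j <- s) (a i - a j) ^+ 2.
  by apply: sumr_ge0 => i _; apply: sumr_ge0 => j _; exact: sqr_ge0.
have -> : \sum_(i <- s) \sum_(j <- s) (a i - a j) ^+ 2 =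
    2 * ((size s)%:R * \sum_(i <- s) a i ^+ 2 - (\sum_(i <- s) a i) ^+ 2).
  transitivity (\sum_(i <- s) ((size s)%:R * a i ^+ 2
      + \sum_(j <- s) a j ^+ 2 - 2 * (a i * \sum_(j <- s) a j))).
    apply: eq_bigr => i _; rewrite -sum_cst !mulr_sumr -big_split/= -sumrB.
    by apply: eq_bigr => j _; ring.
  rewrite sumrB big_split/= sum_cst -!mulr_sumr -mulr_suml; ring.
by rewrite pmulr_rge0// subr_ge0.
Qed.

Section second_moment.
Context {d : measure_display} {Omega : measurableType d} {R : realType}.
Variable P : probability Omega R.
Implicit Types f g : Omega -> R.

Lemma second_moment_ge0 f : (0 <= second_moment P f)%E.
Proof. by apply: expectation_ge0 => w; exact: sqr_ge0. Qed.

Lemma second_moment_scale f (c : R) : measurable_fun [set: Omega] f ->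
  second_moment P (fun w => f w * c) = ((c ^+ 2)%:E * second_moment P f)%E.
Proof.
move=> mf; rewrite /second_moment unlock -ge0_integralZl_EFin ?sqr_ge0//=.
- by apply: eq_integral => w _; rewrite -EFinM exprMn mulrC.
- by move=> w _; rewrite lee_fin sqr_ge0.
- by apply/measurable_EFinP; exact: measurable_funX.
Qed.

(** [sqr_sum_le] is applied at each [w] and integrated; the inequality lives in [\bar R], so
    infinite moments are covered. *)
Lemma second_moment_sum (I : Type) (s : seq I) (f : I -> Omega -> R) :
  (forall i, measurable_fun [set: Omega] (f i)) ->
  (second_moment P (fun w => \sum_(i <- s) f i w)%R <=
   (size s)%:R%:E * \sum_(i <- s) second_moment P (f i))%E.
Proof.
move=> mf; have mf2 i : measurable_fun [set: Omega] (fun w => f i w ^+ 2).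
  exact: measurable_funX.
rewrite /second_moment unlock -ge0_integral_sum//; last 2 first.
- by move=> i; exact/measurable_EFinP.
- by move=> i w _; rewrite lee_fin sqr_ge0.
have msum : measurable_fun [set: Omega]
    (fun w => (\sum_(i <- s) (f i w ^+ 2)%:E)%E).
  by apply: emeasurable_sum => i; exact/measurable_EFinP.
have sum_ge0 w : (0 <= \sum_(i <- s) (f i w ^+ 2)%:E)%E.
  by apply: sume_ge0 => i _; rewrite lee_fin sqr_ge0.
rewrite -ge0_integralZl_EFin//; apply: ge0_le_integral => //.
- by move=> w _; rewrite lee_fin sqr_ge0.
- by apply/measurable_EFinP/measurable_funX/measurable_sum.
- exact: measurable_funeM.
- by move=> w _; rewrite sumEFin -EFinM lee_fin sqr_sum_le.
Qed.

Lemma second_moment_sum_le (I : Type) (s : seq I) (f : I -> Omega -> R) (c : R) :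
  (forall i, measurable_fun [set: Omega] (f i)) ->
  (forall i, (second_moment P (f i) <= c%:E)%E) ->
  (second_moment P (fun w => \sum_(i <- s) f i w)%R <=
   ((size s)%:R ^+ 2 * c)%:E)%E.
Proof.
move=> mf fc; apply: (le_trans (second_moment_sum _ s _ mf)).
rewrite expr2 -mulrA EFinM lee_pmul ?lee_fin//.
  by apply: sume_ge0 => i _; exact: second_moment_ge0.
apply: (@le_trans _ _ (\sum_(i <- s) c%:E)%E); first exact: lee_sum.
by rewrite sumEFin big_const_seq count_predT iter_addr_0 mulr_natl.
Qed.

Lemma second_moment_sub f g :
  measurable_fun [set: Omega] f -> measurable_fun [set: Omega] g ->
  (second_moment P (f \- g)%R <=
   2%:E * (second_moment P f + second_moment P g))%E.
Proof.
move=> mf mg.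
(* Indexing [f] and [-g] by [bool] makes this the two-term case of [second_moment_sum], whence the
   factor 2. *)
have mh b : measurable_fun [set: Omega] (if b then f else \- g)%R.
  by case: b => //; exact: measurableT_comp.
have := second_moment_sum bool [:: true; false] _ mh.
rewrite !big_cons big_nil adde0.
have -> : second_moment P (\- g)%R = second_moment P g.
  by congr expectation; apply/funext => w /=; rewrite sqrrN.
congr (second_moment P _ <= _)%E.
by apply/funext => w; rewrite !big_cons big_nil addr0.
Qed.

End second_moment.

(** * Tagged partitions: widths, mesh, and moving a single tag *)

Section tagged_partition.
Context {R : realType} {a b : R}.
Implicit Type D : tagged_partition a b.

Lemma sample_pt_bounds D (j : 'I_(cells D)) : a <= sample_pt D j <= b.
Proof.
have /andP[lj ju] := sample_pt_itv j.
have nD := nodes_itv_partition D.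
rewrite (le_trans _ lj) ?(le_trans ju)//.
- by apply: itv_partition_nth_le => //; rewrite ltnS ltn_ord.
- by apply: itv_partition_nth_ge => //; rewrite ltnS ltnW.
Qed.

Lemma cell_width_gt0 D (j : 'I_(cells D)) : 0 < cell_width j.
Proof.
have [+ _] := nodes_itv_partition D.
by rewrite subr_gt0 => /(pathP b); apply; exact: ltn_ord.
Qed.

Lemma le_mesh D (j : 'I_(cells D)) : cell_width j <= mesh D.
Proof. exact: le_bigmax. Qed.

Lemma mesh_ge0 D : 0 <= mesh D.
Proof. exact: bigmax_ge_id. Qed.

Lemma sum_cell_width D : \sum_(j < cells D) cell_width j = b - a.
Proof.
rewrite -(big_mkord xpredT (fun j => nth b (a :: nodes D) j.+1
  - nth b (a :: nodes D) j)) telescope_sumr//=.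
congr (_ - _); exact: itv_partition_nth_size (nodes_itv_partition D).
Qed.

(** The widths add up to [b - a] and none exceeds the mesh; hence a small mesh forces many cells. *)
Lemma le_cells_mesh D : b - a <= (cells D)%:R * mesh D.
Proof.
rewrite -(sum_cell_width D) mulr_natl -[X in _ *+ X]card_ord -sumr_const.
by apply: ler_sum => j _; exact: le_mesh.
Qed.

Lemma cvg_mesh : mesh D @[D --> mesh_to0 a b] --> (0 : R).
Proof.
apply/cvgr0Pnorm_lt => e e0; exists e => // D /=.
by rewrite ger0_norm ?mesh_ge0.
Qed.

(** Induction on the nodes with a varying left endpoint: either [t] is at most the first node [x],
    or the remaining nodes partition [[x, b]] and [t] lies there. *)
Lemma in_some_cell D t : a < b -> a <= t <= b ->
  exists j : 'I_(cells D),
    nth b (a :: nodes D) j <= t <= nth b (a :: nodes D) j.+1.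
Proof.
move=> ab; rewrite /cells; have := nodes_itv_partition D.
move: (nodes D) => s {D}.
elim: s a ab => [c cb /itv_partition_nil cE|x s ih c cb H /andP[ct tb]].
  by rewrite cE ltxx in cb.
have [tx|xt] := leP t x; first by exists ord0; rewrite /= ct tx.
have xs := itv_partition_cons H.
have [||j jt] := ih x _ xs; first exact: lt_le_trans xt tb.
  by rewrite ltW.
by exists (lift ord0 j).
Qed.

Section retag.
Variables (D : tagged_partition a b) (j : 'I_(cells D)) (t : R).
Hypothesis jt : nth b (a :: nodes D) j <= t <= nth b (a :: nodes D) j.+1.

Let retag_itv (i : 'I_(size (nodes D))) :
  nth b (a :: nodes D) i <= (if i == j then t else sample_pt D i)
    <= nth b (a :: nodes D) i.+1.
Proof. by case: eqP => [->|_] //; exact: sample_pt_itv. Qed.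

(** The nodes are kept, so the mesh is convertible to that of [D] and estimates for fine partitions
    apply to both. *)
Definition retag := TaggedPartition (nodes_itv_partition D) retag_itv.

Lemma riemann_sum_retag f : riemann_sum f retag - riemann_sum f D =
  (f t - f (sample_pt D j)) * cell_width j.
Proof.
rewrite /riemann_sum -sumrB (bigD1 j)//= big1 ?addr0 ?eqxx -?mulrBl//.
by move=> i /negPf ->; rewrite subrr.
Qed.

End retag.

End tagged_partition.

(** * Existence of partitions of arbitrarily small mesh *)

Lemma uniform_partition (R : realType) (a b : R) n : a < b ->
  exists D : tagged_partition a b, mesh D = (b - a) / n.+1%:R.
Proof.
move=> ab; pose x i : R := a + (b - a) / n.+1%:R * i%:R.
have ba0 : 0 < (b - a) / n.+1%:R by rewrite divr_gt0// subr_gt0.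
(* The list starts at [x 1], because [x 0 = a] is the separate head in [a :: s]. *)
pose s := mkseq (x \o succn) n.+1.
have nth_s i : (i < n.+2)%N -> nth b (a :: s) i = x i.
  by case: i => [_|i ?]; [rewrite /x mulr0 addr0|rewrite /= nth_mkseq].
have szs : size s = n.+1 by rewrite size_mkseq.
have width i : (i < n.+1)%N ->
    nth b (a :: s) i.+1 - nth b (a :: s) i = (b - a) / n.+1%:R.
  by move=> ilt; rewrite (nth_s i.+1)// (nth_s i (leqW ilt)) /x -natr1; ring.
have ps : itv_partition a b s.
  split.
    by apply/(pathP b) => i; rewrite szs => ilt; rewrite -subr_gt0 width.
  rewrite (last_nth b) szs nth_s// /x mulfVK ?pnatr_eq0//.
  by rewrite addrC subrK.
have tag_itv (j : 'I_(size s)) :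
    nth b (a :: s) j <= nth b (a :: s) j <= nth b (a :: s) j.+1.
  by rewrite lexx -subr_ge0 width ?ltW // -szs.
exists (TaggedPartition ps tag_itv); rewrite /mesh /cells /cell_width /=.
apply/eqP; rewrite eq_le; apply/andP; split.
  apply/bigmax_leP; split=> [|j _]; first exact: ltW.
  by rewrite width// -szs.
by rewrite -(width 0%N)//; apply: (le_bigmax _ _ (Ordinal (_ : (0 < size s)%N))).
Qed.

Lemma mesh_to0_proper (R : realType) (a b : R) :
  a < b -> ProperFilter (mesh_to0 a b).
Proof.
move=> ab; apply: Build_ProperFilter_ex => A [e /= e0 eA].
have [n ne] : exists n, (b - a) / n.+1%:R < e.
  (* The integer part plus one exceeds [(b - a) / e]. *)
  exists (Num.truncn ((b - a) / e)).
  by rewrite ltr_pdivrMr// mulrC -ltr_pdivrMr// truncnS_gt.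
have [D mD] := uniform_partition R a b n ab.
by exists D; apply: eA; rewrite /= mD.
Qed.

(** * Mean-square Riemann sums: bounded second moments and dropped cells *)

Section mean_square_sums.
Context {d : measure_display} {Omega : measurableType d} {R : realType}.
Variables (P : probability Omega R) (a b : R) (X : R -> Omega -> R).
Variable Y : Omega -> R.
Hypothesis ab : a < b.
Hypothesis mX : forall t, a <= t <= b -> measurable_fun [set: Omega] (X t).
Hypothesis XY : is_ms_integral P X a b Y.

Let mXw (D : tagged_partition a b) (j : 'I_(cells D)) :
  measurable_fun [set: Omega] (fun w => X (sample_pt D j) w * cell_width j).
Proof.
by apply: measurable_funM => //; exact/mX/sample_pt_bounds.
Qed.

Let mSY (D : tagged_partition a b) :
  measurable_fun [set: Omega] (fun w => ms_riemann_sum X D w - Y w).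
Proof.
apply: measurable_funB; first exact: measurable_sum.
by have [/andP[+ _] _] := XY; rewrite inE.
Qed.

(* Moving one tag u_j of a fine partition to t changes the Riemann sum by
   (X t - X u_j) times the width of cell j, and this change is small in mean
   square, so E[X(t)^2] is controlled by the finitely many E[X(u_j)^2]. *)
Lemma ms_integrable_second_moment_bounded :
  (forall t, a <= t <= b -> (second_moment P (X t) < +oo)%E) ->
  exists M : R, forall t, a <= t <= b -> (second_moment P (X t) <= M%:E)%E.
Proof.
move=> X2; have [_ cvXY] := XY.
have [e /= e0 eD] : \forall D \near mesh_to0 a b,
    (second_moment P (fun w => ms_riemann_sum X D w - Y w)%R < 1)%E.
  apply: (cvXY [set x | (x < 1)%E]); apply: open_nbhs_nbhs.
  by split; [exact: open_ereal_lt_ereal|exact: lte01].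
have [D mD] : exists D : tagged_partition a b, mesh D < e.
  by apply: (@filter_ex _ _ (mesh_to0_proper R a b ab)); exists e.
pose m j := fine (second_moment P (X (sample_pt D j))).
(* Write [X t] as [X u_j - (X u_j - X t)]. The bracket is the difference of the errors of [D] and of
   its retagging, divided by the width of cell [j]; each error has second moment below 1, whence
   [1 + 1], and each 2 comes from [second_moment_sub]. *)
pose c j := 2 * (m j + (cell_width j)^-1 ^+ 2 * (2 * (1 + 1))).
have m_ge0 j : 0 <= m j by rewrite fine_ge0// second_moment_ge0.
have c_ge0 j : 0 <= c j.
  by rewrite mulr_ge0// addr_ge0// mulr_ge0// sqr_ge0.
(* The cell [j] depends on [t]; summing the nonnegative [c j] gives one bound for all [t]. *)
exists (\sum_(j < cells D) c j) => t tab.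
have [j jt] := in_some_cell D t ab tab.
apply: (@le_trans _ _ (c j)%:E); last first.
  by rewrite lee_fin (bigD1 j)//= lerDl sumr_ge0.
have uj := sample_pt_bounds D j.
have wj := cell_width_gt0 D j.
pose D' := retag D j t jt.
have -> : X t = (X (sample_pt D j) \- (X (sample_pt D j) \- X t)).
  by apply/funext => w /=; rewrite opprB addrC subrK.
apply: le_trans (second_moment_sub _ _ _ _ _) _.
- exact: mX.
- by apply: measurable_funB; exact: mX.
rewrite EFinM lee_pmul2l// EFinD leeD//.
  by rewrite fineK// ge0_fin_numE ?second_moment_ge0// X2.
have -> : X (sample_pt D j) \- X t = fun w =>
    ((fun w => ms_riemann_sum X D w - Y w)
     \- (fun w => ms_riemann_sum X D' w - Y w)) w * (cell_width j)^-1.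
  apply/funext => w /=; have := riemann_sum_retag D j t jt (X ^~ w).
  move=> /(canRL (subrK _)); rewrite /ms_riemann_sum => ->.
  by field; rewrite gt_eqF.
rewrite second_moment_scale; last exact: measurable_funB.
rewrite [leRHS]EFinM lee_wpmul2l ?lee_fin ?sqr_ge0//.
apply: le_trans (second_moment_sub _ _ _ _ _) _ => //.
by rewrite EFinM lee_pmul2l// EFinD leeD// ltW//; exact: eD.
Qed.

(** The new error is the error of the full sum minus the dropped part, so its second moment is
    squeezed between 0 and [2 (S D + r D)], where [r D] bounds the dropped part. *)
Lemma ms_integral_drop_cells (K : nat) (M : R)
    (J : forall D : tagged_partition a b, {set 'I_(cells D)}) :
  (forall t, a <= t <= b -> (second_moment P (X t) <= M%:E)%E) ->
  (forall D : tagged_partition a b, (K < cells D)%N -> #|J D| = K) ->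
  is_lim_ms P (mesh_to0 a b) (fun D w =>
    \sum_(j < cells D | j \notin J D) X (sample_pt D j) w * cell_width j) Y.
Proof.
move=> XM JK; have [YL cvXY] := XY; split=> //.
pose S (D : tagged_partition a b) := second_moment P (fun w => ms_riemann_sum X D w - Y w).
pose r (D : tagged_partition a b) := (K%:R ^+ 2 * (mesh D ^+ 2 * M))%:E.
apply: (@squeeze_cvge _ _ _ _ (cst 0%E) _ (fun D => 2%:E * (S D + r D))%E).
(* Since [b - a] is at most the number of cells times the mesh, this forces more than [K] cells, and
   only then does [J D] have a known size. [K = 0] is split off to avoid dividing by zero. *)
- have : \forall D \near mesh_to0 a b, mesh D * K%:R < b - a.
    case: K {JK r} => [|k]; first by apply: nearW => D; rewrite mulr0 subr_gt0.
    by exists ((b - a) / k.+1%:R) => [|D /=];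
      rewrite /= ?divr_gt0 ?subr_gt0 ?ltr_pdivlMr.
  apply: filterS => D KD; rewrite second_moment_ge0/=.
  have {}JK : #|J D| = K.
    apply: JK; rewrite -(ltr_nat R) ltNge; apply/negP => nK.
    move: KD; rewrite ltNge => /negP; apply.
    by rewrite (le_trans (le_cells_mesh D))// mulrC ler_wpM2l ?mesh_ge0.
  pose SJ w := \sum_(j <- enum (J D)) X (sample_pt D j) w * cell_width j.
  rewrite (_ : (fun w => _) =
      (fun w => ms_riemann_sum X D w - Y w) \- SJ); last first.
    apply/funext => w /=; rewrite /SJ big_enum/= /ms_riemann_sum /riemann_sum.
    by rewrite [in RHS](bigID (fun j => j \in J D))/=; ring.
  apply: le_trans (second_moment_sub _ _ _ _ _) _ => //.
    exact: measurable_sum.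
  (* [K] is turned into the length of [enum (J D)], the factor produced by
     [second_moment_sum_le]. *)
  rewrite lee_pmul2l// leeD2l// /r -JK cardE; apply: second_moment_sum_le => //.
  move=> j; rewrite second_moment_scale; last exact/mX/sample_pt_bounds.
  rewrite [leRHS]EFinM lee_pmul ?lee_fin ?sqr_ge0 ?second_moment_ge0//.
    by rewrite lerXn2r ?nnegrE ?mesh_ge0 ?le_mesh// ltW ?cell_width_gt0.
  exact/XM/sample_pt_bounds.
- exact: cvg_cst.
- rewrite -[X in _ --> X](mule0 2%:E); apply: cvgeZl => //.
  rewrite -[X in _ --> X]adde0; apply: cvgeD => //.
  apply: cvg_EFin; first exact: nearW.
  rewrite [X in _ --> X](_ : 0 = K%:R ^+ 2 * (0 ^+ 2 * M)); last by ring.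
  apply: cvgMr; apply: cvgMl.
  by rewrite !expr2; apply: cvgM; exact: cvg_mesh.
Qed.

End mean_square_sums.

Theorem theorem2 (d : measure_display) (Omega : measurableType d)
    (R : realType) (P : probability Omega R) (T : R) (X : R -> Omega -> R)
    (K : nat) (J : forall D : tagged_partition 0 T, {set 'I_(cells D)}) :
  0 < T ->
  (forall t : R, 0 <= t <= T -> measurable_fun [set: Omega] (X t)) ->
  (forall t : R, 0 <= t <= T -> (second_moment P (X t) < +oo)%E) ->
  ms_integrable P X 0 T ->
  (exists M : R, forall t : R, 0 <= t <= T ->
     `|fine (second_moment P (X t))| <= M) \/
  riemann_integrable (fun t => fine (second_moment P (X t))) 0 T ->
  (1 <= K)%N ->
  (forall D : tagged_partition 0 T, (K < cells D)%N -> #|J D| = K) ->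
  is_lim_ms P (mesh_to0 0 T)
    (fun D w => \sum_(j < cells D) X (sample_pt D j) w * cell_width j)
    (ms_integral P X 0 T) /\
  is_lim_ms P (mesh_to0 0 T)
    (fun D w => \sum_(j < cells D | j \notin J D) X (sample_pt D j) w * cell_width j)
    (ms_integral P X 0 T).

Proof.
move=> T0 mX X2 iX _ _ JK.
(* Integrability supplies a witness, so the version chosen by [xget] is a genuine integral and not
   the default [cst 0]. *)
have XY : is_ms_integral P X 0 T (ms_integral P X 0 T).
  by case: iX => Y XY; exact: (xgetI _ XY).
split; first exact: XY.
have [M XM] := ms_integrable_second_moment_bounded _ _ _ _ _ T0 mX XY X2.
exact: ms_integral_drop_cells XM JK.
Qed.
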